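(* Let $H$ be a subgraph of a graph $G$. Then $G\searrow^{d} H$ (i.e. $G$ is dismantlable on $H$) if and only if $H$ is a strong deformation retract of $G$.
   Context: Graphs are finite, undirected, without parallel edges; loops are allowed. $x\sim y$ means that $x$ and $y$ are adjacent, and $N_G(x)=\{y\in V(G): y\sim x\}$ is the open neighborhood (so $x\in N_G(x)$ iff $x$ is looped). A vertex $x$ of $G$ is dismantlable if there is another vertex $a\neq x$ of $G$ with $N_G(x)\subset N_G(a)$. $G\searrow^{d}H$ ($G$ is dismantlable on the subgraph $H$) means: $H$ is the subgraph of $G$ induced by $V(H)$ and one can write $V(G)\setminus V(H)=\{x_1,\dots,x_k\}$ ($k\ge 0$, distinct $x_i$) so that, for each $i$, $x_i$ is dismantlable in the subgraph of $G$ induced by $V(H)\cup\{x_i,x_{i+1},\dots,x_k\}$. A morphism of graphs $f:G\to G'$ is a map $V(G)\to V(G')$ with $x\sim y\Rightarrow f(x)\sim f(y)$. The graph $\mathrm{hom}_{\mathscr G}(G,G')$ has the morphisms $G\to G'$ as vertices, with $f\sim f'$ iff for all $x,y\in V(G)$, $x\sim y$ in $G$ implies $f(x)\sim f'(y)$ in $G'$. For an integer $N\geq 1$, $I_N$ is the reflexive graph with looped vertices $0,1,\dots,N$ and adjacencies $0\sim1\sim\dots\sim N$. A retraction of $G$ to a subgraph $G'$ is a morphism $r:G\to G'$ with $r(x)=x$ for all $x\in V(G')$. A subgraph $G'$ of $G$ is a strong deformation retract of $G$ if for some $N\ge 1$ there is a graph morphism $\mathcal H:I_N\to \mathrm{hom}_{\mathscr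 G}(G,G)$, $i\mapsto \mathcal H_i$, such that $\mathcal H_0=1_G$, $\mathcal H_i(x)=x$ for all $x\in V(G')$ and all $i\in\{1,\dots,N\}$, and $\mathcal H_N$ is a retraction of $G$ to $G'$. *)

(* Defs.v *)
From HB Require Import structures.
From mathcomp Require Import all_boot.

Set Implicit Arguments.
Unset Strict Implicit.
Unset Printing Implicit Defensive.

Record graph := Graph {
  vertex :> finType;
  adj : rel vertex;
  adj_sym : symmetric adj }.

Definition nbhd (G : graph) (x : G) : {set G} := [set y | adj y x].

(* The inclusion of neighborhoods is not required to be strict. *)
Definition dismantlable (G : graph) (x : G) : Prop :=
  exists a : G, a != x /\ nbhd x \subset nbhd a.

(* A subgraph need not be induced: it has its own edges, which join two of its
   vertices and are edges of [G]. *)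
Record subgraph (G : graph) := Subgraph {
  sverts : {set G};
  sadj : rel G;
  sadj_sym : symmetric sadj;
  sadj_verts : forall x y, sadj x y -> x \in sverts /\ y \in sverts;
  sadj_adj : forall x y, sadj x y -> adj x y }.

Section GraphOfSubgraph.
Variables (G : graph) (H : subgraph G).

Definition sub_adj : rel {x : G | x \in sverts H} :=
  fun x y => sadj H (val x) (val y).

Lemma sub_adj_sym : symmetric sub_adj.
Proof. by move=> x y; apply: sadj_sym. Qed.

Definition graph_of_subgraph : graph := Graph sub_adj_sym.

End GraphOfSubgraph.

Coercion graph_of_subgraph : subgraph >-> graph.

Section Induced.
Variables (G : graph) (A : {set G}).

Definition induced_adj : rel G := fun x y => [&& x \in A, y \in A & adj x y].

Lemma induced_adj_sym : symmetric induced_adj.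
Proof. by move=> x y; rewrite /induced_adj adj_sym andbCA. Qed.

Lemma induced_adj_verts x y : induced_adj x y -> x \in A /\ y \in A.
Proof. by case/and3P. Qed.

Lemma induced_adj_adj x y : induced_adj x y -> adj x y.
Proof. by case/and3P. Qed.

Definition induced : subgraph G :=
  Subgraph induced_adj_sym induced_adj_verts induced_adj_adj.

End Induced.

Definition is_induced (G : graph) (H : subgraph G) : Prop :=
  sadj H =2 sadj (induced (sverts H)).

Section DismantlableOn.
Variables (G : graph) (H : subgraph G).

Definition remaining (k : nat) (x : 'I_k -> G) (i : 'I_k) : {set G} :=
  sverts H :|: [set x j | j : 'I_k & i <= j].

Lemma mem_remaining k (x : 'I_k -> G) i : x i \in remaining x i.
Proof. by rewrite inE; apply/orP; right; apply: imset_f; rewrite inE. Qed.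

Definition remaining_vertex (k : nat) (x : 'I_k -> G) (i : 'I_k) :
    induced (remaining x i) :=
  exist _ (x i) (mem_remaining x i).

Definition dismantlable_on : Prop :=
  is_induced H /\
  exists (k : nat) (x : 'I_k -> G),
    [/\ injective x,
        ~: sverts H = [set x i | i : 'I_k] &
        forall i : 'I_k, dismantlable (remaining_vertex x i)].

End DismantlableOn.

Definition is_morphism (G G' : graph) (f : {ffun G -> G'}) : bool :=
  [forall x, forall y, adj x y ==> adj (f x) (f y)].

Record morphism (G G' : graph) := Morphism {
  morph_fun :> {ffun G -> G'};
  morph_funP : is_morphism morph_fun }.

HB.instance Definition _ (G G' : graph) :=
  [isSub for @morph_fun G G'].
HB.instance Definition _ (G G' : graph) :=
  [Finite of morphism G G' by <:].

Lemma id_is_morphism (G : graph) : is_morphism [ffun x : G => x].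
Proof. by apply/'forall_forallP=> x y; rewrite !ffunE implybb. Qed.

Definition id_morphism (G : graph) : morphism G G :=
  Morphism (id_is_morphism G).

Section HomGraph.
Variables G G' : graph.

Definition hom_adj : rel (morphism G G') :=
  fun f f' => [forall x, forall y, adj x y ==> adj (f x) (f' y)].

Lemma hom_adj_sym : symmetric hom_adj.
Proof.
suff sub f f' : hom_adj f f' -> hom_adj f' f by move=> f f'; apply/idP/idP; apply: sub.
move=> /'forall_forallP h; apply/'forall_forallP=> x y.
by rewrite adj_sym [adj (f' x) _]adj_sym; apply: h.
Qed.

Definition hom_graph : graph := Graph hom_adj_sym.

End HomGraph.

Section PathGraph.
Variable N : nat.

Definition path_adj : rel 'I_N.+1 :=
  fun i j => [|| i == j, j == i.+1 :> nat | i == j.+1 :> nat].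

Lemma path_adj_sym : symmetric path_adj.
Proof. by move=> i j; rewrite /path_adj eq_sym [X in _ || X]orbC. Qed.

Definition path_graph : graph := Graph path_adj_sym.

End PathGraph.

Definition is_retraction (G : graph) (G' : subgraph G) (r : morphism G G') :
    Prop :=
  forall x : G', r (val x) = x.

(* The endomorphism [h N] of [G] is identified with a morphism [r : G -> G']
   through the inclusion of [G'] in [G]; since [r] must be a morphism to [G'],
   its values and the images of edges have to lie in [G']. *)
Definition strong_deformation_retract (G : graph) (G' : subgraph G) : Prop :=
  exists (N : nat) (h : morphism (path_graph N) (hom_graph G G)),
    [/\ 1 <= N,
        h ord0 = id_morphism G,
        forall (i : 'I_N.+1) (x : G),
          1 <= i -> x \in sverts G' -> (h i : morphism G G) x = x &
        exists r : morphism G G',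
          is_retraction r /\
          forall x : G, (h ord_max : morphism G G) x = val (r x)].

(* Main.v *)
Require Import Defs.
From mathcomp Require Import all_boot.

Set Implicit Arguments.
Unset Strict Implicit.
Unset Printing Implicit Defensive.

(** Removing a dismantlable vertex [x] is the same thing as folding it onto a
    vertex [a] that dominates it.  The fold is a morphism, and the inclusion
    of neighborhoods says exactly that it is adjacent to the identity in the
    graph of endomorphisms.

    If the vertices outside of [H] can be removed one by one, the successive
    composites of the folds form a path of endomorphisms which fix [H]; it
    starts at the identity and ends at a retraction to [H].

    Conversely, consider a path of endomorphisms from the identity to a
    retraction to [H].  If every map on it is the identity, there is nothing
    outside of [H].  Otherwise the first map that is not the identity is
    adjacent to the identity, so each vertex [x] that it moves is dominated by
    its image and can be removed.  Composing the whole path with the fold of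
    [x] gives a path of endomorphisms of the smaller graph with the same
    properties, and induction on the number of vertices concludes.  That [H]
    is an induced subgraph is seen on the retraction: it fixes [H] and sends
    edges of [G] to edges of [H].

    Both inductions run through induced subgraphs of a fixed graph, so the
    argument is carried out on sets of vertices ([dismantlesP]), and the two
    sides of the equivalence are translated into that language separately
    ([dismantlable_onE] and [strong_deformation_retractE]). *)

Section VertexSets.
Variable G : graph.
Implicit Types (A S : {set G}) (x a y : G).

Definition dominates A x a : Prop :=
  [/\ a \in A, a != x & {in A, forall y, adj y x -> adj y a}].

Inductive dismantles S : {set G} -> Prop :=
| DismantlesRefl : dismantles S S
| DismantlesStep A x a : x \in A -> x \notin S -> dominates A x a ->
    dismantles S (A :\ x) -> dismantles S A.

(** A path in the endomorphism graph of the subgraph induced by [A].  The maps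
    are total and the path is infinite, with a condition on all indices from
    [N] on; in this way neither restrictions of maps to subtypes nor ordinals
    appear when paths are composed or prolonged. *)
Record deformation S A (N : nat) (f : nat -> G -> G) : Prop := Deformation {
  deform_sub : S \subset A;
  deform_start : {in A, f 0 =1 id};
  deform_stable : forall i, {in A, forall x, f i x \in A};
  deform_fix : forall i, {in S, f i =1 id};
  deform_morph : forall i,
    {in A &, forall x y, adj x y -> adj (f i x) (f i y)};
  deform_step : forall i,
    {in A &, forall x y, adj x y -> adj (f i x) (f i.+1 y)};
  deform_end : forall i, N <= i -> {in A, forall x, f i x \in S} }.

(** * Folding a vertex onto a dominating one *)

Definition fold x a y : G := if y == x then a else y.

Lemma fold_id x a y : y != x -> fold x a y = y.
Proof. by rewrite /fold => /negbTE->. Qed.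

Lemma fold_fix S x a y : x \notin S -> y \in S -> fold x a y = y.
Proof. by move=> xS yS; apply: fold_id; apply: contraNneq xS => <-. Qed.

Lemma fold_in A x a y : dominates A x a -> y \in A -> fold x a y \in A :\ x.
Proof.
by case=> aA ax _ yA; rewrite /fold; case: eqP => [_|/eqP yx]; rewrite !inE ?ax ?yx.
Qed.

Lemma fold_adj_id A x a : dominates A x a ->
  {in A &, forall y z, adj y z -> adj y (fold x a z)}.
Proof.
case=> aA ax dom y z yA zA yz; rewrite /fold; case: eqP => // zx.
by apply: dom; rewrite -?zx.
Qed.

(** Folding the endpoints one after the other covers the case of a loop at
    [x] without a case analysis. *)
Lemma fold_morph A x a : dominates A x a ->
  {in A &, forall y z, adj y z -> adj (fold x a y) (fold x a z)}.
Proof.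
move=> dom y z yA zA yz.
have /setD1P[_ fzA] := fold_in dom zA.
rewrite adj_sym; apply: (fold_adj_id dom) => //.
by rewrite adj_sym; apply: (fold_adj_id dom).
Qed.

(** * Dismantlings and deformations *)

(** The fold comes first: its image is the smaller set, where the given path
    takes over. *)
Lemma deformation_prepend S A N f x a :
  x \in A -> x \notin S -> dominates A x a -> deformation S (A :\ x) N f ->
  deformation S A N.+1
    (fun i => if i is j.+1 then f j \o fold x a else id).
Proof.
move=> xA xS dom [sub start stable fx morph step fin].
have fA y : y \in A -> fold x a y \in A :\ x := fold_in dom.
split=> //.
- exact: subset_trans sub (subD1set _ _).
- case=> [|i] y yA //=.
  by have /setD1P[] := stable i _ (fA _ yA).
- by case=> [|i] y yS //=; rewrite (fold_fix _ xS yS) fx.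
- case=> [|i] y z yA zA yz //=.
  by apply: morph; [exact: fA | exact: fA | exact: (fold_morph dom)].
- case=> [|i] y z yA zA yz /=.
    by rewrite start ?fA //; apply: (fold_adj_id dom).
  by apply: step; [exact: fA | exact: fA | exact: (fold_morph dom)].
- by case=> [|i] // Ni y yA; apply: fin => //; apply: fA.
Qed.

Lemma deformation_fold S A N f x a :
  x \in A -> x \notin S -> dominates A x a -> deformation S A N f ->
  deformation S (A :\ x) N (fun i => fold x a \o f i).
Proof.
move=> xA xS dom [sub start stable fx morph step fin].
split=> [|y|i y|i y yS|i y z|i y z|i Ni y] /=; first by rewrite subsetD1 sub.
- by case/setD1P=> yx yA; rewrite start ?fold_id.
- by case/setD1P=> _ yA; apply: fold_in => //; apply: stable.
- by rewrite fx // (fold_fix _ xS yS).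
- move=> /setD1P[_ yA] /setD1P[_ zA] yz.
  by apply: (fold_morph dom); [exact: stable | exact: stable | exact: morph].
- move=> /setD1P[_ yA] /setD1P[_ zA] yz.
  by apply: (fold_morph dom); [exact: stable | exact: stable | exact: step].
- by case/setD1P=> _ yA; rewrite (fold_fix _ xS) // fin.
Qed.

(** The first map of the path that is not the identity on [A] is adjacent to
    the identity, hence dominates every vertex that it moves. *)
Lemma deformation_dominates S A N f : deformation S A N f -> A != S ->
  exists x a, [/\ x \in A, x \notin S & dominates A x a].
Proof.
move=> [sub start stable fx _ step fin] AS.
have moves : exists i, [exists x in A, f i x != x].
  exists N; apply/contraR: AS => /exists_inPn fixN.
  rewrite eqEsubset sub andbT; apply/subsetP=> x xA.
  by have /negPn/eqP <- := fixN x xA; apply: fin.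
case: (ex_minnP moves) => -[|i] /exists_inP[x xA fix_x] min_i.
  by rewrite start ?eqxx in fix_x.
have fi_id : {in A, f i =1 id}.
  move=> y yA; apply/eqP/negPn/negP=> fiy.
  by have := min_i i; rewrite ltnn => /(_ _)/negP[]//; apply/exists_inP; exists y.
exists x, (f i.+1 x); split=> //; first by apply: contra fix_x => xS; rewrite fx.
split=> //; first exact: stable.
by move=> y yA yx; rewrite -{1}(fi_id y yA); apply: step.
Qed.

(** From right to left, a vertex provided by [deformation_dominates] is
    removed and the deformation is folded, by induction on the size of [A]. *)
Lemma dismantlesP S A :
  dismantles S A <-> exists N f, deformation S A N f.
Proof.
split.
  elim=> [|{}A x a xA xS dom _ [N [f def]]].
    by exists 0, (fun=> id); split=> // i *.
  by exists N.+1; eexists; apply: (deformation_prepend xA xS dom def).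
move=> [N [f]]; have [n] := ubnP #|A|; elim: n => // n IHn in A f *.
move=> /ltnSE leAn def; have [->|AS] := eqVneq A S; first exact: DismantlesRefl.
have [x [a [xA xS dom]]] := deformation_dominates def AS.
apply: (DismantlesStep xA xS dom); apply: (IHn _ (fun i => fold x a \o f i)).
  by move: leAn; rewrite (cardsD1 x A) xA.
exact: deformation_fold.
Qed.

(** * Dismantlings as enumerations of the removed vertices *)

Lemma dismantlable_induced A (v : induced A) :
  dismantlable v <-> exists a, dominates A (val v) a.
Proof.
split.
  move=> [a [av /subsetP sub]]; exists (val a); split=> //; first exact: valP.
  move=> y yA yv.
  have := sub (exist _ y yA); rewrite !inE /= /sub_adj /= /induced_adj yA yv.
  by rewrite (valP v) (valP a); apply.
move=> [a [aA av dom]]; exists (exist _ a aA); split; first by rewrite -val_eqE.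
apply/subsetP=> y; rewrite !inE /= /sub_adj /= /induced_adj.
by case/and3P=> yA vA yv; rewrite yA aA dom.
Qed.

Lemma dismantles_of_enum S k (x : 'I_k -> G) :
  injective x -> ~: S = [set x i | i : 'I_k] ->
  (forall i : 'I_k, exists a,
     dominates (S :|: [set x j | j : 'I_k & i <= j]) (x i) a) ->
  dismantles S setT.
Proof.
move=> x_inj xS dom.
pose T i := S :|: [set x j | j : 'I_k & i <= j].
have xnS i : x i \notin S by rewrite -in_setC xS imset_f.
(* T k is S and T 0 is the whole graph, so induct on k - i. *)
suff tail m i : i + m = k -> dismantles S (T i).
  have -> : setT = T 0; last exact: tail (add0n k).
  rewrite -(setUCr S) xS /T; congr (_ :|: _).
  apply/setP=> z.
  by apply/imsetP/imsetP=> -[j _ ->]; exists j; rewrite ?inE.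
elim: m i => [|m IHm] i eik.
  suff -> : T i = S by exact: DismantlesRefl.
  apply/setUidPl/subsetP=> _ /imsetP[j + ->]; rewrite inE.
  by rewrite -[i]addn0 eik leqNgt ltn_ord.
have lt_ik : i < k by rewrite -eik addnS ltnS leq_addr.
have [a dom_a] := dom (Ordinal lt_ik).
apply: (DismantlesStep _ (xnS _) dom_a).
  by rewrite !inE imset_f ?orbT // inE.
suff -> : T i :\ x (Ordinal lt_ik) = T i.+1 by apply: IHm; rewrite addSnnS.
apply/setP=> z; rewrite !inE; have [->|zi] /= := eqVneq z _.
  rewrite (negbTE (xnS _)) /=; apply/esym/imsetP=> -[j + /x_inj ji].
  by rewrite inE -ji /= ltnn.
congr (_ || _); apply/imsetP/imsetP=> -[j]; rewrite inE => lij zj; exists j => //.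
  rewrite inE ltn_neqAle lij andbT; apply: contra_neq zi => ij.
  by rewrite zj; congr x; apply: val_inj.
by rewrite inE ltnW.
Qed.

(** The sets that are left at each stage are written with [S] and the suffixes
    of [s], as [remaining] does, rather than as [A] minus the prefixes. *)
Lemma enum_of_dismantles S A : dismantles S A ->
  exists s : seq G,
    [/\ uniq s, S \subset A, A :\: S =i s &
        forall x0 i, i < size s ->
          exists a, dominates (S :|: [set z in drop i s]) (nth x0 s i) a].
Proof.
elim=> [|{}A x a xA xS dom _ [s [s_uniq sub eq_s dom_s]]].
  by exists [::]; split=> // x; rewrite setDv inE.
have sA : S :|: [set z in x :: s] = A.
  apply/setP=> z; rewrite !inE -eq_s !inE; have [->|_] /= := eqVneq z x.
    by rewrite orbT xA.
  case: (boolP (z \in S)) => //= zS.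
  by have := subsetP sub z zS; rewrite inE => /andP[_ ->].
exists (x :: s); split=> [||z|x0 [|i]] /=.
- by rewrite s_uniq -eq_s !inE eqxx andbF.
- exact: subset_trans sub (subD1set _ _).
- rewrite !inE -eq_s !inE.
  by have [->|] := eqVneq z x; rewrite ?xA ?xS.
- by move=> _; exists a; rewrite sA.
- exact: dom_s.
Qed.

End VertexSets.

Lemma dismantlable_onE (G : graph) (H : subgraph G) :
  dismantlable_on H <-> is_induced H /\ dismantles (sverts H) setT.
Proof.
split=> -[indH].
  move=> [k [x [x_inj xS dom]]]; split=> //; apply: (dismantles_of_enum x_inj xS).
  by move=> i; have /dismantlable_induced := dom i.
move=> /enum_of_dismantles[s [s_uniq _ eq_s dom]]; split=> //.
exists (size s), (tnth (in_tuple s)); split.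
- exact/tuple_uniqP.
- apply/setP=> z; have := eq_s z; rewrite !inE andbT => ->.
  apply/idP/imsetP=> [/(tnthP (in_tuple s))[i ->]|[i _ ->]]; first by exists i.
  exact: mem_tnth.
move=> i; apply/dismantlable_induced => /=.
have x0 := tnth (in_tuple s) i.
suff -> : remaining H (tnth (in_tuple s)) i
          = sverts H :|: [set z in drop i s].
  by rewrite (tnth_nth x0) /=; apply: dom.
apply/setP=> z; rewrite !inE; congr (_ || _); apply/imsetP/idP.
  move=> [j + ->]; rewrite inE => lij.
  rewrite (tnth_nth x0) /= -(subnKC lij) -nth_drop mem_nth //.
  by rewrite size_drop ltn_sub2r // (leq_ltn_trans lij).
move=> /(nthP x0)[j]; rewrite size_drop ltn_subRL => ljs <-.
exists (Ordinal ljs); first by rewrite inE leq_addr.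
by rewrite (tnth_nth x0) nth_drop.
Qed.

(** * Deformations as morphisms from a path graph *)

Lemma morphismP (G G' : graph) (f : morphism G G') (x y : G) :
  adj x y -> adj (f x) (f y).
Proof. by move=> xy; have /'forall_'forall_implyP := morph_funP f; apply. Qed.

Lemma hom_adjP (G G' : graph) (f f' : morphism G G') :
  reflect (forall x y, adj x y -> adj (f x) (f' y)) (hom_adj f f').
Proof. exact: 'forall_'forall_implyP. Qed.

(** An edge of [G] between vertices of [H] is sent by the retraction to an edge
    of [H], with the same endpoints. *)
Lemma retract_is_induced (G : graph) (H : subgraph G) (r : morphism G H) :
  is_retraction r -> is_induced H.
Proof.
move=> ret x y; apply/idP/and3P=> [Hxy|[xH yH xy]].
  by have [] := sadj_verts Hxy; rewrite (sadj_adj Hxy).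
have := morphismP r xy.
by rewrite (ret (exist _ x xH)) (ret (exist _ y yH)).
Qed.

Lemma deformation_of_path (G : graph) (H : subgraph G) :
  strong_deformation_retract H ->
  exists N f, deformation (sverts H) setT N f.
Proof.
move=> [N [h [_ h0 hfix [r [_ hr]]]]].
(* Prolong the path of length N by its last map. *)
pose o i : 'I_N.+1 := inord (minn i N).
have oE i : o i = minn i N :> nat by rewrite inordK // ltnS geq_minr.
have o0 : o 0 = ord0 by apply: val_inj; rewrite /= oE min0n.
exists N, (fun i => h (o i) : morphism G G); split=> //.
- by move=> x _; rewrite o0 h0 ffunE.
- by move=> i x _; rewrite inE.
- move=> i x xS; have [oi|oi] := posnP (o i); last exact: hfix.
  by have -> : o i = ord0 by [apply: val_inj]; rewrite h0 ffunE.
- by move=> i x y _ _; apply: morphismP.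
- move=> i x y _ _; apply/hom_adjP; apply: (morphismP h).
  rewrite /= /path_adj -val_eqE /= !oE.
  have [lt_iN|le_Ni] := ltnP i N.
    by rewrite (minn_idPl lt_iN) eqxx orbT.
  by rewrite (minn_idPr (leqW le_Ni)) eqxx.
- move=> i le_Ni x _; have -> : o i = ord_max.
    by apply: val_inj; rewrite /= oE (minn_idPr le_Ni).
  by rewrite hr (valP (r x)).
Qed.

Section PathOfDeformation.
Variables (G : graph) (H : subgraph G) (N : nat) (f : nat -> G -> G).
Hypotheses (indH : is_induced H) (def : deformation (sverts H) setT N f).

Lemma deformation_is_morphism i : is_morphism (G := G) (G' := G) (finfun (f i)).
Proof.
apply/'forall_'forall_implyP=> x y xy.
by rewrite !ffunE; apply: (deform_morph def).
Qed.

Definition deformation_morphism i : morphism G G :=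
  Morphism (deformation_is_morphism i).

Lemma deformation_hom_adj i j :
  i = j \/ j = i.+1 ->
  hom_adj (deformation_morphism i) (deformation_morphism j).
Proof.
move=> ij; apply/hom_adjP=> x y xy; rewrite !ffunE.
by case: ij => ->; [apply: (deform_morph def) | apply: (deform_step def)].
Qed.

Lemma deformation_path_morphism M :
  is_morphism (G := path_graph M) (G' := hom_graph G G)
    [ffun i : 'I_M.+1 => deformation_morphism i].
Proof.
apply/'forall_'forall_implyP=> i j; rewrite !ffunE.
case/or3P=> [/eqP->|/eqP ij|/eqP ij]; try by apply: deformation_hom_adj; auto.
by rewrite /= hom_adj_sym; apply: deformation_hom_adj; auto.
Qed.

(** The index is [N.+1] because that is where [path_of_deformation] stops. *)
Definition deformation_end_vertex x : H :=
  exist _ (f N.+1 x) (deform_end def (leqnSn N) (in_setT x)).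

Lemma deformation_end_is_morphism :
  is_morphism (G := G) (G' := H) (finfun deformation_end_vertex).
Proof.
apply/'forall_'forall_implyP=> x y xy; rewrite !ffunE /= /sub_adj /= indH.
by rewrite /= /induced_adj !(deform_end def) ?in_setT //= (deform_morph def).
Qed.

Lemma path_of_deformation : strong_deformation_retract H.
Proof.
(* The length of the path has to be positive, and N may be 0. *)
exists N.+1, (Morphism (deformation_path_morphism N.+1)); split=> //.
- apply: val_inj; apply/ffunP=> x.
  by rewrite /= !ffunE (deform_start def) ?in_setT.
- by move=> i x _ xH; rewrite /= !ffunE (deform_fix def).
exists (Morphism deformation_end_is_morphism); split=> x; rewrite /= ffunE.
  by apply: val_inj; rewrite /= (deform_fix def) ?(valP x).
by rewrite /= !ffunE.
Qed.

End PathOfDeformation.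

Lemma strong_deformation_retractE (G : graph) (H : subgraph G) :
  strong_deformation_retract H <->
  is_induced H /\ exists N f, deformation (sverts H) setT N f.
Proof.
split=> [sdr|[indH [N [f def]]]]; last exact: path_of_deformation def.
split; last exact: deformation_of_path.
by case: sdr => [_ [_ [_ _ _ [r [ret _]]]]]; apply: retract_is_induced ret.
Qed.

Theorem proposition2p2 (G : graph) (H : subgraph G) :
  dismantlable_on H <-> strong_deformation_retract H.
Proof.
apply: iff_trans (dismantlable_onE H) _.
apply: iff_trans _ (iff_sym (strong_deformation_retractE H)).
by split=> -[indH /dismantlesP def]; split.
Qed.
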